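(* Let $f:\mathbb{R}^d\to\mathbb{R}$ be $\mu$-strongly convex and $L$-smooth with respect to the Euclidean norm, where $0<\mu\le L$, and let $\mathbf{x}_*$ be its minimizer. Let $\epsilon>0$ and $c:=\frac{2\sqrt{\mu L}}{\mu+L}$. Then $$V_{\epsilon,c}\subset\left\{\mathbf{x}\in\mathbb{R}^d:\|\mathbf{x}-\mathbf{x}_*\|_2\le\frac{L}{2\mu}\left(1+\frac1c\right)\epsilon\sqrt d\right\}.$$
   Context: Let $\mathbf{e}_i$ be the standard basis vectors; $m_i(\mathbf{x}):=\frac{f(\mathbf{x}+\epsilon\mathbf{e}_i)-f(\mathbf{x}-\epsilon\mathbf{e}_i)}{2\epsilon}$, $r_i(\mathbf{x}):=\frac{f(\mathbf{x}+\epsilon\mathbf{e}_i)+f(\mathbf{x}-\epsilon\mathbf{e}_i)-2f(\mathbf{x})}{2\epsilon}$, $M(\mathbf{x}):=\|\mathbf{m}(\mathbf{x})\|_2$, $R(\mathbf{x}):=\|\mathbf{r}(\mathbf{x})\|_2$, and $V_{\epsilon,c}:=\{\mathbf{x}\in\mathbb{R}^d:M(\mathbf{x})\le R(\mathbf{x})/c\}$. A differentiable convex $f$ is $\mu$-strongly convex if $f(\mathbf{x})\ge f(\mathbf{y})+\langle\nabla f(\mathbf{y}),\mathbf{x}-\mathbf{y}\rangle+\frac\mu2\|\mathbf{x}-\mathbf{y}\|_2^2$ for all $\mathbf{x},\mathbf{y}$; a differentiable $f$ is $L$-smooth if $\|\nabla f(\mathbf{x})-\nabla f(\mathbf{y})\|_2\le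 L\|\mathbf{x}-\mathbf{y}\|_2$ for all $\mathbf{x},\mathbf{y}$. *)

(* Defs.v *)
From HB Require Import structures.
From mathcomp Require Import all_boot all_order all_algebra.
From mathcomp Require Import all_classical all_reals all_analysis.

Set Implicit Arguments.
Unset Strict Implicit.
Unset Printing Implicit Defensive.

Import Order.TTheory GRing.Theory Num.Theory.
Import numFieldNormedType.Exports.

Local Open Scope classical_set_scope.
Local Open Scope ring_scope.

Section Euclidean.
Context {R : realType} {d : nat}.
Implicit Types x y : 'rV[R]_d.

Definition inner x y : R := \sum_(i < d) x 0 i * y 0 i.

(* The library norm `|x| on 'rV[R]_d is the sup norm, so the Euclidean norm
   is defined here.  The sup norm only enters through differentiability, where
   the choice of norm is immaterial in finite dimension. *)
Definition norm2 x : R := Num.sqrt (inner x x).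

Definition basis_vec (i : 'I_d) : 'rV[R]_d := delta_mx 0 i.

End Euclidean.

Section Functions.
Context {R : realType} {d : nat}.
Implicit Types (f : 'rV[R]_d -> R) (x : 'rV[R]_d).

Definition grad f x : 'rV[R]_d := \row_(i < d) 'D_(basis_vec i) f x.

Definition strongly_convex (mu : R) f : Prop :=
  [/\ forall x, differentiable f x,
      convex_function [set: convex_lmodType 'rV[R]_d] f &
      forall x y,
        f y + inner (grad f y) (x - y) + mu / 2 * norm2 (x - y) ^+ 2 <= f x].

Definition L_smooth (L : R) f : Prop :=
  (forall x, differentiable f x) /\
  forall x y, norm2 (grad f x - grad f y) <= L * norm2 (x - y).

Definition is_minimizer f x : Prop := forall y, f x <= f y.

End Functions.

Section FiniteDifferences.
Context {R : realType} {d : nat}.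
Variables (f : 'rV[R]_d -> R) (eps : R).

Definition m_vec (x : 'rV[R]_d) : 'rV[R]_d := \row_(i < d)
  ((f (x + eps *: basis_vec i) - f (x - eps *: basis_vec i)) / (2 * eps)).

Definition r_vec (x : 'rV[R]_d) : 'rV[R]_d := \row_(i < d)
  ((f (x + eps *: basis_vec i) + f (x - eps *: basis_vec i) - 2 * f x)
   / (2 * eps)).

Definition M_fun (x : 'rV[R]_d) : R := norm2 (m_vec x).

Definition R_fun (x : 'rV[R]_d) : R := norm2 (r_vec x).

Definition V_set (c : R) : set 'rV[R]_d := [set x | M_fun x <= R_fun x / c].

End FiniteDifferences.

(* Main.v *)
Require Import Defs.
From mathcomp Require Import all_boot all_order all_algebra.
From mathcomp Require Import all_classical all_reals all_analysis.
From mathcomp Require Import ring lra.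
Import Order.TTheory GRing.Theory Num.Theory.
Import numFieldNormedType.Exports.
Local Open Scope classical_set_scope.
Local Open Scope ring_scope.

(** Expanding f at x +- eps e_i gives f(x) +- eps g_i + delta_i^{+-}, where g is
    the gradient at x and 0 <= delta_i^{+-} <= L eps^2 / 2 by convexity and
    smoothness.  Hence |m_i - g_i| <= r_i <= L eps / 2, so that
    mu |x - x_*| <= |g| <= M + R <= (1 + 1/c) R <= (1 + 1/c) L eps sqrt d / 2
    on V_{eps,c}, the first inequality being strong convexity. *)

Section Inner.
Context {R : realType} {d : nat}.
Implicit Types x y z : 'rV[R]_d.

Lemma innerC x y : inner x y = inner y x.
Proof. by apply: eq_bigr => i _; rewrite mulrC. Qed.

Lemma innerDl x y z : inner (x + y) z = inner x z + inner y z.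
Proof. by rewrite -big_split; apply: eq_bigr => i _; rewrite mxE mulrDl. Qed.

Lemma innerZl (a : R) x y : inner (a *: x) y = a * inner x y.
Proof. by rewrite big_distrr; apply: eq_bigr => i _; rewrite mxE /= mulrA. Qed.

Lemma innerNl x y : inner (- x) y = - inner x y.
Proof. by rewrite -scaleN1r innerZl mulN1r. Qed.

Lemma inner0l x : inner 0 x = 0.
Proof. by rewrite -(scale0r 0) innerZl mul0r. Qed.

Lemma inner_basis_vec x (i : 'I_d) : inner x (basis_vec i) = x 0 i.
Proof.
rewrite /inner (bigD1 i) //= big1 => [|j ji].
  by rewrite mxE !eqxx mulr1 addr0.
by rewrite mxE eqxx (negbTE ji) mulr0.
Qed.

Lemma inner_ge0 x : 0 <= inner x x.
Proof. by apply: sumr_ge0 => i _; rewrite -expr2 sqr_ge0. Qed.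

Lemma norm2_ge0 x : 0 <= norm2 x.
Proof. exact: sqrtr_ge0. Qed.

Lemma sqr_norm2 x : norm2 x ^+ 2 = inner x x.
Proof. by rewrite sqr_sqrtr // inner_ge0. Qed.

Lemma norm2N x : norm2 (- x) = norm2 x.
Proof. by rewrite /norm2 innerNl innerC innerNl opprK. Qed.

Lemma norm2Z (a : R) x : norm2 (a *: x) = `|a| * norm2 x.
Proof.
rewrite /norm2 innerZl innerC innerZl mulrA -expr2 sqrtrM ?sqr_ge0 //.
by rewrite sqrtr_sqr.
Qed.

Lemma norm2_basis_vec (i : 'I_d) : norm2 (basis_vec i : 'rV[R]_d) = 1.
Proof. by rewrite /norm2 inner_basis_vec mxE !eqxx sqrtr1. Qed.

Lemma norm2_eq0 x : norm2 x = 0 -> x = 0.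
Proof.
move=> x0; have /eqP : inner x x = 0 by rewrite -sqr_norm2 x0 expr0n.
rewrite /inner psumr_eq0 => [/allP xx0|i _]; last by rewrite -expr2 sqr_ge0.
apply/rowP => i; have := xx0 i (mem_index_enum i).
by rewrite mxE mulf_eq0 orbb => /eqP.
Qed.

(** Cauchy-Schwarz: for nonzero [x] and [y], the squared length of |y| x - |x| y expands to 2 |x|
    |y| (|x| |y| - <x, y>), which is nonnegative; the positive factor is then cancelled. *)
Lemma inner_le_norm2 x y : inner x y <= norm2 x * norm2 y.
Proof.
have [x0|x_neq0] := eqVneq (norm2 x) 0.
  by rewrite (norm2_eq0 x x0) inner0l mulr_ge0 ?norm2_ge0.
have [y0|y_neq0] := eqVneq (norm2 y) 0.
  by rewrite (norm2_eq0 y y0) innerC inner0l mulr_ge0 ?norm2_ge0.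
have x_gt0 : 0 < norm2 x by rewrite lt_def x_neq0 norm2_ge0.
have y_gt0 : 0 < norm2 y by rewrite lt_def y_neq0 norm2_ge0.
have := inner_ge0 (norm2 y *: x - norm2 x *: y).
rewrite innerDl innerNl !innerZl ![inner _ (_ - _)]innerC !(innerDl, innerNl).
rewrite !innerZl (innerC y x) -!sqr_norm2 => xy_ge0.
rewrite -subr_ge0 -(pmulr_rge0 _ (mulr_gt0 x_gt0 y_gt0)).
by move: xy_ge0; set a := norm2 x; set b := norm2 y; set p := inner x y; nra.
Qed.

Lemma ler_norm2D x y : norm2 (x + y) <= norm2 x + norm2 y.
Proof.
rewrite -(@ler_pXn2r _ 2) ?nnegrE ?addr_ge0 ?norm2_ge0 // sqrrD !sqr_norm2.
rewrite innerDl ![inner _ (_ + _)]innerC !innerDl (innerC y x).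
by have := inner_le_norm2 x y; lra.
Qed.

Lemma ler_abs_norm2 x (i : 'I_d) : `|x 0 i| <= norm2 x.
Proof.
rewrite -sqrtr_sqr ler_wsqrtr // /inner (bigD1 i) //= -expr2 lerDl.
by apply: sumr_ge0 => j _; rewrite -expr2 sqr_ge0.
Qed.

(** Turns coordinatewise bounds into Euclidean ones; the hypothesis forces the entries of [y] to be
    nonnegative, so squaring preserves it. *)
Lemma ler_norm2 x y : (forall i, `|x 0 i| <= y 0 i) -> norm2 x <= norm2 y.
Proof.
move=> xy; rewrite ler_wsqrtr //; apply: ler_sum => i _.
by rewrite -!expr2 -[x 0 i ^+ 2]real_normK ?num_real // ler_pXn2r
  ?nnegrE ?(le_trans _ (xy i)).
Qed.

Lemma norm2_const_mx (a : R) :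
  0 <= a -> norm2 (const_mx a : 'rV[R]_d) = a * Num.sqrt d%:R.
Proof.
move=> a0; rewrite /norm2 /inner; under eq_bigr do rewrite !mxE -expr2.
rewrite sumr_const card_ord -[_ *+ d]mulr_natr sqrtrM ?sqr_ge0 // sqrtr_sqr.
by rewrite ger0_norm.
Qed.

End Inner.

(** Subtracting the linear and quadratic terms from [phi] leaves [h], whose derivative is <= 0 on
    the right of 0 and >= 0 on the left. By the mean value theorem [h] is largest at 0. *)
Lemma quadratic_upper_bound (R : realType) (phi dphi : R -> R) (L t : R) :
  (forall s, is_derive s (1 : R) phi (dphi s)) ->
  (forall s, `|dphi s - dphi 0| <= L * `|s|) ->
  phi t <= phi 0 + t * dphi 0 + L / 2 * t ^+ 2.
Proof.
move=> dphiP lip.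
pose h s := phi s - s * dphi 0 - L / 2 * s ^+ 2.
pose dh s := dphi s - dphi 0 - L * s.
have hP s : is_derive s (1 : R) h (dh s).
  have D := dphiP s.
  apply: is_derive_eq.
  by rewrite /dh /GRing.scale /=; field.
(* Stated for every interval, since the sign of [t] decides between [0, t] and [t, 0]. *)
have hc (i : interval R) : {within [set` i], continuous h}.
  by apply: derivable_within_continuous => s _; have [] := hP s.
have h0 : h 0 = phi 0 by rewrite /h expr0n /=; ring.
suff : h t <= h 0 by rewrite h0 /h; lra.
have [t0|/ltW t0] := leP 0 t.
- have [s /itvP s_itv] := MVT_segment t0 (fun s _ => hP s) (hc _).
  have := lip s; rewrite (ger0_norm (x := s)) ?s_itv // /dh ler_norml => /andP[_].
  by nra.
- have [s /itvP s_itv] := MVT_segment t0 (fun s _ => hP s) (hc _).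
  have s0 : s <= 0 by rewrite s_itv.
  have := lip s; rewrite (ler0_norm s0) /dh ler_norml => /andP[+ _].
  by nra.
Qed.

Section StronglyConvexSmooth.
Context {R : realType} {d : nat}.
Variables (f : 'rV[R]_d -> R) (mu L : R).
Implicit Types (x : 'rV[R]_d) (i : 'I_d).

(** On the line through [x] along the unit vector e_i, the derivative of [f] is the i-th gradient
    coordinate, which inherits the Lipschitz constant [L]. *)
Lemma L_smooth_coord_le x i (t : R) : L_smooth L f ->
  f (x + t *: basis_vec i) <= f x + t * grad f x 0 i + L / 2 * t ^+ 2.
Proof.
move=> [df lip].
pose phi s := f (x + s *: basis_vec i).
pose dphi s := grad f (x + s *: basis_vec i) 0 i.
have x0 : x + 0 *: basis_vec i = x by rewrite scale0r addr0.
have phiP s : is_derive s (1 : R) phi (dphi s).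
  (* Identifies the difference quotients of [phi] at [s] with those of the directional derivative of
     [f], giving both derivability and its value. *)
  have shiftE : (fun h : R => h^-1 *: ((phi \o shift s) (h *: 1) - phi s)) =
      (fun h => h^-1 *: ((f \o shift (x + s *: basis_vec i))
        (h *: basis_vec i) - f (x + s *: basis_vec i))).
    apply/funext => h; rewrite /phi /= scalerDl addrCA.
    by rewrite /GRing.scale /= mulr1.
  split; first by rewrite /derivable shiftE; exact: diff_derivable.
  by rewrite /derive shiftE /dphi mxE.
have := @quadratic_upper_bound R phi dphi L t phiP.
rewrite /phi /dphi x0; apply => s.
have := lip (x + s *: basis_vec i) x.
rewrite [x + _ - x]addrAC subrr add0r norm2Z norm2_basis_vec mulr1; apply: le_trans.
by have := ler_abs_norm2 (grad f (x + s *: basis_vec i) - grad f x) i; rewrite !mxE.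
Qed.

Lemma strongly_convex_coord_ge x i (t : R) : 0 <= mu -> strongly_convex mu f ->
  f x + t * grad f x 0 i <= f (x + t *: basis_vec i).
Proof.
move=> mu0 [_ _ sc]; have := sc (x + t *: basis_vec i) x.
rewrite [x + _ - x]addrAC subrr add0r innerC innerZl innerC inner_basis_vec.
by apply: le_trans; rewrite lerDl mulr_ge0 ?sqr_ge0 ?divr_ge0.
Qed.

Lemma grad_minimizer x : 0 < L -> L_smooth L f -> is_minimizer f x ->
  grad f x = 0.
Proof.
move=> L0 sm xmin; apply/rowP => i; rewrite [RHS]mxE.
(* A gradient step of length 1/L would decrease f by g_i^2 / (2 L). *)
set g := grad f x 0 i.
have := le_trans (xmin _) (@L_smooth_coord_le x i (- (g / L)) sm).
rewrite -/g => step.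
have gL : - (g / L) * g + L / 2 * (- (g / L)) ^+ 2 = - (g ^+ 2 / (2 * L)).
  by field; rewrite gt_eqF.
have : g ^+ 2 / (2 * L) <= 0 by move: gL step; lra.
rewrite pmulr_lle0 ?invr_gt0 ?mulr_gt0 // => g2.
by apply/eqP; rewrite -sqrf_eq0 eq_le g2 sqr_ge0.
Qed.

(** Adding the strong convexity inequalities for (x, y) and (y, x) cancels the values of [f] and
    leaves mu |x - y|^2 <= <grad f x, x - y>. Cauchy-Schwarz and division by |x - y| finish. *)
Lemma strongly_convex_norm2_grad_ge x y : strongly_convex mu f ->
  grad f y = 0 -> mu * norm2 (x - y) <= norm2 (grad f x).
Proof.
move=> [_ _ sc] gy.
have := sc x y; rewrite gy inner0l.
have := sc y x; rewrite -(opprB x y) norm2N innerC innerNl innerC.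
have := inner_le_norm2 (grad f x) (x - y) => cs h1 h2.
have [->|n0] := eqVneq (norm2 (x - y)) 0; first by rewrite mulr0 norm2_ge0.
have n_gt0 : 0 < norm2 (x - y) by rewrite lt_def n0 norm2_ge0.
by rewrite -(ler_pM2r n_gt0); lra.
Qed.

End StronglyConvexSmooth.

Theorem theorem6p4 (R : realType) (d : nat) (f : 'rV[R]_d -> R) (mu L : R)
    (xs : 'rV[R]_d) (eps : R)
    (hmu : 0 < mu) (hmuL : mu <= L)
    (hsc : strongly_convex mu f) (hL : L_smooth L f)
    (hmin : is_minimizer f xs) (heps : 0 < eps) :
  let c := 2 * Num.sqrt (mu * L) / (mu + L) in
  V_set f eps c `<=`
  [set x : 'rV[R]_d |
    norm2 (x - xs) <= L / (2 * mu) * (1 + 1 / c) * eps * Num.sqrt d%:R].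
Proof.
move=> c x; rewrite /V_set /= => xV.
have L0 : 0 < L by exact: lt_le_trans hmuL.
have c0 : 0 < c by rewrite divr_gt0 ?addr_gt0 // mulr_gt0 // sqrtr_gt0 mulr_gt0.
have eps2 : 0 < 2 * eps by rewrite mulr_gt0.
pose g := grad f x.
(* Makes the backward point an instance of [lo] and [up] at t = -eps. *)
have fE (i : 'I_d) : f (x - eps *: basis_vec i) = f (x + (- eps) *: basis_vec i).
  by rewrite scaleNr.
have lo (i : 'I_d) t := strongly_convex_coord_ge f mu x i t (ltW hmu) hsc.
have up (i : 'I_d) t := L_smooth_coord_le f L x i t hL.
(* After multiplication by 2 eps, the two sides of |g_i - m_i| <= r_i are twice the tangent bounds
   [lo] at eps and -eps. *)
have gm_le : norm2 (g - m_vec f eps x) <= R_fun f eps x.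
  apply: ler_norm2 => i; rewrite ![(_ - _ : 'rV_d) 0 i]mxE [(- _ : 'rV_d) 0 i]mxE.
  rewrite [m_vec _ _ _ _ _]mxE [r_vec _ _ _ _ _]mxE fE ler_norml -mulNr.
  rewrite ler_pdivrMr // ler_pdivlMr //.
  have -> u : (g 0 i - u / (2 * eps)) * (2 * eps) = 2 * eps * g 0 i - u.
    by field; rewrite gt_eqF.
  have := lo i eps; have := lo i (- eps); rewrite -/g => ? ?.
  by apply/andP; split; lra.
(* The terms in g_i cancel in the second difference, so [lo] and [up] give 0 <= r_i <= L eps / 2;
   the constant vector of this bound produces the factor sqrt d. *)
have R_le : R_fun f eps x <= L / 2 * eps * Num.sqrt d%:R.
  rewrite -norm2_const_mx; last by rewrite !mulr_ge0 ?invr_ge0 ?ltW.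
  apply: ler_norm2 => i; rewrite [r_vec _ _ _ _ _]mxE [const_mx _ _ _]mxE fE.
  have := lo i eps; have := lo i (- eps); have := up i eps; have := up i (- eps).
  rewrite -/g => *; rewrite ger0_norm ?ler_pdivrMr //; first by lra.
  by apply: divr_ge0; [lra | exact: ltW].
(* Here membership in [V_set] enters, as M <= R / c in |g| <= |g - m| + M. *)
have g_le : norm2 g <= R_fun f eps x * (1 + 1 / c).
  have := ler_norm2D (g - m_vec f eps x) (m_vec f eps x).
  rewrite subrK => /le_trans; apply.
  by rewrite mulrDr mulr1 mul1r lerD.
have grad_xs := grad_minimizer f L xs L0 hL hmin.
have mu_le := le_trans (strongly_convex_norm2_grad_ge f mu x xs hsc grad_xs) g_le.
have k0 : 0 <= 1 + 1 / c.
  by apply: addr_ge0 => //; apply: divr_ge0 => //; exact: ltW.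
have {}mu_le := le_trans mu_le (ler_wpM2r k0 R_le).
rewrite -(ler_pM2l hmu); apply: (le_trans mu_le); rewrite le_eqVlt; apply/orP; left.
by apply/eqP; field; rewrite !gt_eqF.
Qed.
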